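(* Let $q$ be a prime power. Then $\varphi$ (defined in the context) is a surjective map from the set $\mathbb{M}_q$ of monomial clones on $\mathbb{F}_q$ to the set of $0$-preserving semi-affine clones with respect to $(\mathbb{Z}_{q-1},+,-,0)$. Furthermore, for every $0$-preserving semi-affine clone $C$ with respect to $(\mathbb{Z}_{q-1},+,-,0)$ the following hold: (1) If $C$ is the clone on $\mathbb{Z}_{q-1}$ generated by $\emptyset$ (the clone of projections), then $\{G\in\mathbb{M}_q\mid\varphi(G)=C\}=\{\langle\{x_1\}\rangle,\langle\{x_1x_2^{q-1}\}\rangle\}$. (2) If for all $G\in\mathbb{M}_q$ with $\varphi(G)=C$ we have $x_1x_2^{q-1}\in G$, then $|\{G\in\mathbb{M}_q\mid\varphi(G)=C\}|=1$. (3) If $q-1$ is square-free, then $\{G\in\mathbb{M}_q\mid\varphi(G)=C\}$ is finite.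
   Context: $\mathbb{N}=\{1,2,\dots\}$, $\mathbb{N}_0=\mathbb{N}\cup\{0\}$, $\mathbb{F}_q$ is the field with $q$ elements. A monomial is a formal product $g=\prod_{i\in\mathbb{N}}x_i^{\alpha(i)}$ with $\alpha(i)\in\mathbb{N}_0$, finitely many but at least one $\alpha(i)$ nonzero (so $1$ is not a monomial); $\mathrm{mI}(g)$ is the largest $i$ with $\alpha(i)\neq0$, called the arity of $g$. For $n\ge\mathrm{mI}(g)$ the $n$-ary induced function is $g^{\mathbb{F}_q^n}\colon\mathbb{F}_q^n\to\mathbb{F}_q$, $(x_1,\dots,x_n)\mapsto\prod_{i=1}^nx_i^{\alpha(i)}$. Monomials $m_1,m_2$ are equivalent if the $\mathrm{mI}(m_1)$-ary induced function of $m_1$ equals the $\mathrm{mI}(m_2)$-ary induced function of $m_2$ (i.e. for each $i$ the exponents of $x_i$ in $m_1$ and $m_2$ are equal, or both positive and congruent modulo $q-1$). A clone on a set $A$ is a set of finitary operations on $A$ (of arities $\ge1$) containing all projections and closed under composition. A set $M$ of monomials is a monomial clone on $\mathbb{F}_q$ if $\{m^{\mathbb{F}_q^n}\mid m\in M,\ n\ge\mathrm{mI}(m)\}$ is a clone on $\mathbb{F}_q$ and $M$ is closed under equivalent monomials. For a set $M'$ of monomials, $\langle M'\rangle$ is the least monomial clone on $\mathbb{F}_q$ containing $M'$. $\mathbb{M}_q$ is the set of all monomial clones on $\mathbb{F}_q$. Let $\mathbf{A}=(A,+,-,0)$ be an abelian group. An $n$-ary operation $f$ on $A$ is affine with respect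 to $\mathbf{A}$ if $f(u+v)+f(0,\dots,0)=f(u)+f(v)$ for all $u,v\in A^n$ (componentwise addition); it is $0$-preserving if $f(0,\dots,0)=0$. A clone $C$ on $A$ is a $0$-preserving semi-affine clone with respect to $\mathbf{A}$ if every $f\in C$ is affine with respect to $\mathbf{A}$ and $0$-preserving. For $a\in\mathbb{N}_0$, $[a]\in\mathbb{Z}_{q-1}$ is the class of $a$ modulo $q-1$. For a set $G$ of monomials, $$\varphi(G):=\Big\{f\colon\mathbb{Z}_{q-1}^n\to\mathbb{Z}_{q-1},\ (y_1,\dots,y_n)\mapsto\sum_{i=1}^n[r(i)]y_i\ \Big|\ n\in\mathbb{N},\ \prod_{i=1}^nx_i^{r(i)}\in G\Big\}$$ (exponents $r(i)\in\mathbb{N}_0$). *)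

(* Defs.v *)
From mathcomp Require Import all_boot all_order all_algebra.
From mathcomp Require Import mathcomp_extra boolp classical_sets functions.
From mathcomp Require Import cardinality.
From mathcomp Require Import finmap monalg.

Set Implicit Arguments.
Unset Strict Implicit.
Unset Printing Implicit Defensive.

Import GRing.Theory.
Local Open Scope classical_set_scope.
Local Open Scope ring_scope.

(** Variables are numbered from 0: the index [i : nat] stands for the variable
    x_{i+1}, and likewise [i : 'I_n] for the (i+1)-th argument of an n-ary
    operation. *)

Definition op (A : Type) (n : nat) : Type := {ffun 'I_n -> A} -> A.

Definition operation (A : Type) : Type := {n : nat & op A n}.

Definition mkop (A : Type) (n : nat) (f : op A n) : operation A :=
  existT (op A) n f.

Definition is_clone (A : Type) (C : set (operation A)) : Prop :=
  [/\ forall f, C f -> (0 < projT1 f)%N,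
      forall (n : nat) (i : 'I_n), C (mkop (fun x : {ffun 'I_n -> A} => x i))
    & forall (n m : nat) (f : op A n) (g : 'I_n -> op A m),
        C (mkop f) -> (forall i, C (mkop (g i))) ->
        C (mkop (fun x : {ffun 'I_m -> A} => f [ffun i => g i x]))].

Definition affine_op (A : zmodType) (n : nat) (f : op A n) : Prop :=
  forall u v : {ffun 'I_n -> A}, f (u + v) + f 0 = f u + f v.

Definition zero_preserving (A : zmodType) (n : nat) (f : op A n) : Prop :=
  f 0 = 0.

Definition is_semi_affine0_clone (A : zmodType) (C : set (operation A)) : Prop :=
  is_clone C /\
  forall (n : nat) (f : op A n), C (mkop f) -> affine_op f /\ zero_preserving f.

(** [{cmonom nat}] contains the empty product [mone], which is not a monomial
    here. *)
Definition monomial : Type := {m : {cmonom nat} | m != mone}.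

Definition mI (m : monomial) : nat := (\max_(i <- finsupp (val m)) i.+1)%N.

Definition induced (F : finFieldType) (m : monomial) (n : nat) : op F n :=
  fun x => \prod_(i < n) x i ^+ (val m) i.

Definition equiv_monomial (F : finFieldType) (m1 m2 : monomial) : Prop :=
  mkop (@induced F m1 (mI m1)) = mkop (@induced F m2 (mI m2)).

Definition induced_ops (F : finFieldType) (M : set monomial) :
    set (operation F) :=
  [set f | exists (m : monomial) (n : nat),
     [/\ M m, (mI m <= n)%N & f = mkop (@induced F m n)]].

Definition is_monomial_clone (F : finFieldType) (M : set monomial) : Prop :=
  is_clone (@induced_ops F M) /\
  forall m1 m2, equiv_monomial F m1 m2 -> M m1 -> M m2.

Definition monomial_clones (F : finFieldType) : set (set monomial) :=
  [set M | is_monomial_clone F M].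

Definition gen_monomial_clone (F : finFieldType) (M : set monomial) :
    set monomial :=
  smallest (@is_monomial_clone F) M.

(** The integers modulo q - 1 for q >= 2. This is not ['Z_(q.-1)], which for
    q = 2 has two elements instead of one; ['I_k.+1] carries the additive group
    of integers modulo k + 1 for every k. *)
Notation Zqm1 q := 'I_(q.-2).+1.

(** [Zp_mul] is the multiplication modulo q - 1; it is used rather than the ring
    product because the library gives no ring structure to ['I_1]. *)
Definition linear_op (q n : nat) (r : 'I_n -> nat) : op (Zqm1 q) n :=
  fun y => \sum_(i < n) Zp_mul (inZp (r i)) (y i).
Arguments linear_op q n r : clear implicits.

Definition phi (q : nat) (G : set monomial) : set (operation (Zqm1 q)) :=
  [set f | exists (n : nat) (r : 'I_n -> nat) (m : monomial),
     [/\ (0 < n)%N, G m,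
         val m = \big[mmul/mone]_(i < n) expcmn (ucm (nat_of_ord i)) (r i)
       & f = mkop (linear_op q n r)]].

Arguments phi q G : clear implicits.

Definition phi_fiber (F : finFieldType) (q : nat)
    (C : set (operation (Zqm1 q))) : set (set monomial) :=
  [set G | monomial_clones F G /\ phi q G = C].
Arguments phi_fiber F q C : clear implicits.

Lemma x1_neq1 : ucm 0%N != mone :> {cmonom nat}.
Proof. by rewrite cm1_eq1. Qed.

Lemma x1x2X_neq1 (k : nat) :
  mmul (ucm 0%N) (expcmn (ucm 1%N) k) != mone :> {cmonom nat}.
Proof. by rewrite cmM_eq1 cm1_eq1. Qed.

(** The monomials x_1 and x_1 x_2^k. *)
Definition x1 : monomial :=
  exist (fun m : {cmonom nat} => m != mone) _ x1_neq1.
Definition x1x2X (k : nat) : monomial :=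
  exist (fun m : {cmonom nat} => m != mone) _ (x1x2X_neq1 k).

Definition square_free (n : nat) : Prop :=
  forall d : nat, (d ^ 2 %| n)%N -> d = 1%N.

(* Main.v *)
Require Import Defs.
From mathcomp Require Import all_boot all_order all_algebra.
From mathcomp Require Import mathcomp_extra boolp classical_sets functions.
From mathcomp Require Import cardinality.
From mathcomp Require Import all_fingroup all_solvable all_field.
From mathcomp Require Import finmap monalg ring.

(** Let N = q - 1. A function x^a on the field with q elements is determined by
    whether a is zero and by the class of a modulo N, so exponents live in the
    semiring Z_N with a new zero adjoined, and a monomial clone is the same
    thing as a set of finitely supported nonzero exponent functions that is
    invariant under this equivalence, contains the unit vectors and is closed
    under substitution ([monomial_cloneP]). The map phi forgets the difference
    between exponent 0 and exponent N; it takes substitution to composition of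
    linear operations, and 0-preserving affine operations over Z_N are exactly
    the linear ones, so phi lands in the semi-affine clones.

    Given a semi-affine clone C, all monomials whose linear operation lies in C
    form a monomial clone [full_preimage C]; it is the largest element of the
    fiber of C, which gives surjectivity.

    Fibers are controlled by one question: when may a factor x_l^N be
    multiplied to a member of G? If this is possible for some m in G, as often
    as desired, then every monomial m' with the same exponents modulo N is in G
    ([clone_lift]): multiply m by x_l^N for every l to make its support full,
    then rename the variables outside the support of m' to one inside it, which
    adds multiples of N to a positive exponent. If x_1 x_2^N is in G, such
    factors are always available, so G is the full preimage; if this holds for
    all G in a fiber, the fiber has one element. A clone in the fiber of the
    projections that has a monomial with two variables contains x_1 x_2^N;
    otherwise it consists of powers x_i^a with a congruent to 1, so this fiber
    has exactly two elements.

    Square-freeness of N gives for each a some L > 0 with a^(L+1) congruent to a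
    ([squarefree_expn_idem]). Nesting a monomial with at least two variables
    into itself then produces the factor x_l^N ([clone_expand]). Hence all monomials in G with at least two variables
    whose exponent is nonzero modulo N are determined by phi(G), and so are
    those with only one variable. What remains is equivalent up to adding
    factors x_l^N to some x_1^a x_2^N, so G is determined by phi(G) and the
    finite set of classes a for which this monomial is in G
    ([phi_fiber_sub]). *)

Set Implicit Arguments.
Unset Strict Implicit.
Unset Printing Implicit Defensive.

Local Open Scope classical_set_scope.
Local Open Scope card_scope.

(** * Exponent functions and their clones *)

(** When N + 1 is the number of elements of the field, this is equality of the
    induced power functions in each variable. *)
Definition expo_equiv (N : nat) (e e' : nat -> nat) : Prop :=
  forall i, (e i == 0) = (e' i == 0) /\ e i = e' i %[mod N].

Definition vanishes_from (n : nat) (e : nat -> nat) : Prop :=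
  forall i, n <= i -> e i = 0.

Definition var_expo (i : nat) : nat -> nat := fun j => (i == j : nat).

Definition subst_expo (n : nat) (e : nat -> nat) (s : nat -> nat -> nat) :
    nat -> nat :=
  fun j => \sum_(i < n) e i * s i j.

(** The exponent form of a monomial clone: [subst_expo n e s] is the exponent
    of the monomial with exponent [e] after each variable [i < n] has been
    replaced by the monomial with exponent [s i]. *)
Definition expo_clone (N : nat) (E : set (nat -> nat)) : Prop :=
  [/\ forall i, E (var_expo i),
      forall n e s, vanishes_from n e -> E e -> (forall i, E (s i)) ->
        E (subst_expo n e s)
    & forall e e', expo_equiv N e e' -> E e -> E e'].

Lemma expo_equiv_refl N e : expo_equiv N e e.
Proof. by []. Qed.

Lemma expo_equiv_sym N e e' : expo_equiv N e e' -> expo_equiv N e' e.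
Proof. by move=> h i; have [-> ->] := h i. Qed.

Lemma expo_equiv_trans N e1 e2 e3 :
  expo_equiv N e1 e2 -> expo_equiv N e2 e3 -> expo_equiv N e1 e3.
Proof. by move=> h h' i; have [-> ->] := h i; exact: h'. Qed.

Lemma vanishes_equiv N n e e' :
  expo_equiv N e e' -> vanishes_from n e -> vanishes_from n e'.
Proof. by move=> h v i /v /eqP ei; apply/eqP; have [<- _] := h i. Qed.

Lemma vanishes_leq n n' e :
  n <= n' -> vanishes_from n e -> vanishes_from n' e.
Proof. by move=> nn v i /(leq_trans nn) /v. Qed.

Lemma sum_delta n (f : nat -> nat) j :
  \sum_(i < n) f i * (i == j :> nat) = if j < n then f j else 0.
Proof.
under eq_bigr => i _ do rewrite mulnbr.
rewrite -big_mkcond /=; case: ltnP => jn.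
  by rewrite (big_pred1 (Ordinal jn)).
by rewrite big_pred0 // => i; apply/negbTE; rewrite neq_ltn (leq_trans (ltn_ord i)).
Qed.

Lemma modn_sum (I : Type) (r : seq I) (P : pred I) N (f g : I -> nat) :
  (forall i, P i -> f i = g i %[mod N]) ->
  \sum_(i <- r | P i) f i = \sum_(i <- r | P i) g i %[mod N].
Proof.
move=> fg; elim/big_rec2: _ => // i x y Pi xy.
by rewrite -modnDm (fg _ Pi) xy modnDm.
Qed.

Lemma subst_expo_equiv N n e e' s s' :
    expo_equiv N e e' -> (forall i, expo_equiv N (s i) (s' i)) ->
  expo_equiv N (subst_expo n e s) (subst_expo n e' s').
Proof.
move=> ee ss j; split.
  rewrite !sum_nat_eq0; apply: eq_forallb => i /=.
  by rewrite !muln_eq0 (ee i).1 (ss i j).1.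
by apply: modn_sum => i _; rewrite -modnMm (ee i).2 (ss i j).2 modnMm.
Qed.

Section ExponentClones.

Variables (N : nat) (E : set (nat -> nat)).
Hypotheses (N0 : 0 < N) (cE : expo_clone N E).

Lemma clone_var i : E (var_expo i). Proof. by case: cE. Qed.

Lemma clone_subst n e s : vanishes_from n e -> E e -> (forall i, E (s i)) ->
  E (subst_expo n e s).
Proof. by case: cE => _ h _; exact: h. Qed.

Lemma clone_equiv e e' : expo_equiv N e e' -> E e -> E e'.
Proof. by case: cE => _ _ h; exact: h. Qed.

(** The variables are renamed by [f], which need not be injective: exponents of
    identified variables add up. *)
Lemma clone_rename n e (f : nat -> nat) : vanishes_from n e -> E e ->
  E (fun j => \sum_(i < n) e i * (f i == j)).
Proof.
move=> v Ee; apply: (@clone_subst n e (fun i => var_expo (f i))) => // i.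
exact: clone_var.
Qed.

Definition times_xN (k : nat) (e : nat -> nat) : nat -> nat :=
  fun j => e j + N * (k == j).

(** Modulo N, an exponent function determines membership as soon as factors
    x_k^N are freely available: such factors make the support of [e] full, and
    then every variable outside the support of [e'] is absorbed, with an
    exponent divisible by N, into one fixed variable [j0] of the support of
    [e']. The set [T] records a property that ensures that such factors can be
    added and that survives their addition. *)
Lemma clone_lift (T : set (nat -> nat)) n e e' :
    T `<=` E -> (forall e k, T e -> T (times_xN k e)) -> T e ->
    (forall i, e i = e' i %[mod N]) ->
    vanishes_from n e -> vanishes_from n e' -> (exists i, 0 < e' i) -> E e'.
Proof.
move=> TE TX Te ee' ve ve' [j0 ej0].
have T1 l : T (fun j => e j + N * (j < l)).
  elim: l => [|l IH].
    by rewrite (_ : (fun _ => _) = e) //; apply/funext => j; rewrite ltn0 muln0 addn0.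
  have := TX _ l IH; congr T; apply/funext => j.
  rewrite /times_xN -addnA -mulnDr; congr (_ + N * _).
  by rewrite ltnS; case: ltngtP.
(* Renaming by [f] keeps the support of e' and empties its complement. *)
pose f i := if 0 < e' i then i else j0.
have e'f i : 0 < e' (f i) by rewrite /f; case: ifP.
have ve1 : vanishes_from n (fun j => e j + N * (j < n)).
  by move=> i ni; rewrite ve // ltnNge ni muln0.
have := clone_rename f ve1 (TE _ (T1 n)).
apply: clone_equiv => j; split.
  apply/idP/idP.
    move=> s0; apply/negPn; rewrite -lt0n; apply/negP => ej.
    have jn : j < n by rewrite ltnNge; apply/negP => /ve' e0; rewrite e0 in ej.
    move: s0; rewrite sum_nat_eq0 => /forallP /(_ (Ordinal jn)) /=.
    by rewrite {1}/f ej eqxx muln1 jn muln1 addn_eq0 -[N == 0]negbK -lt0n N0 andbF.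
  move=> /eqP ej; rewrite sum_nat_eq0; apply/forallP => i /=.
  have /negbTE -> : f i != j by apply/eqP => fij; have := e'f i; rewrite fij ej.
  by rewrite muln0.
have -> : e' j = \sum_(i < n) e' i * (i == j :> nat).
  by rewrite sum_delta; case: ltnP => // /ve'.
apply: modn_sum => i _; rewrite ltn_ord muln1.
case: (posnP (e' i)) => ei.
  by rewrite ei mul0n -modnMm modnDr (ee' i) ei mod0n mul0n mod0n.
by rewrite -modnMm modnDr (ee' i) modnMm /f ei.
Qed.

(** If all exponents other than that of [u] are divisible by N, identifying
    the variables different from [u] turns them into a single N-th power. *)
Lemma clone_merge n e u w : vanishes_from n e -> E e ->
    u != w -> 0 < e u -> 0 < e w -> (forall v, u != v -> e v = 0 %[mod N]) ->
  E (fun j => e u * (0 == j) + N * (1 == j)).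
Proof.
move=> ve Ee uw eu ew eN.
have lt_n v : 0 < e v -> v < n.
  by move=> ev; rewrite ltnNge; apply/negP => /ve e0; rewrite e0 in ev.
have := clone_rename (fun v => if v == u then 0 else 1) ve Ee.
apply: clone_equiv => j; rewrite (bigD1 (Ordinal (lt_n _ eu))) //= eqxx.
pose S := \sum_(v < n | v != Ordinal (lt_n _ eu)) e v.
have S0 : 0 < S.
  rewrite /S (bigD1 (Ordinal (lt_n _ ew))) /= ?addn_gt0 ?ew //.
  by rewrite -val_eqE eq_sym.
have SN : S = 0 %[mod N].
  have -> : 0 = \sum_(v < n | v != Ordinal (lt_n _ eu)) 0 by rewrite big1.
  by apply: modn_sum => v; rewrite -val_eqE eq_sym => /eN.
rewrite (_ : \sum_(_ < n | _) _ = S * (1 == j)); last first.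
  rewrite /S big_distrl; apply: eq_bigr => v vi.
  by rewrite -val_eqE /= in vi; rewrite (negbTE vi).
split.
  by rewrite !addn_eq0 !muln_eq0 (gtn_eqF eu) (gtn_eqF S0) (gtn_eqF N0).
by rewrite -modnDmr -modnMml SN mod0n mul0n mod0n addn0 -[in RHS]modnDmr modnMr addn0.
Qed.

End ExponentClones.

(** For square-free N the ring Z_N is a product of finite fields, so every
    element recurs among its own higher powers. Concretely, with d the gcd of
    a and N, the number M = N / d is coprime to d, hence to a, and Euler's
    theorem modulo M gives the exponent. *)
Lemma squarefree_expn_idem N a : 0 < N -> square_free N ->
  exists2 L, 0 < L & a ^ L.+1 = a %[mod N].
Proof.
move=> N0 sN; set d := gcdn a N; set M := N %/ d.
have dN : N = d * M by rewrite mulnC divnK // dvdn_gcdr.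
have M0 : 0 < M by move: N0; rewrite dN muln_gt0 => /andP[].
have dM : coprime d M.
  apply/eqP; apply: sN; rewrite dN -mulnn; apply: dvdn_mul.
    exact: dvdn_gcdl.
  exact: dvdn_gcdr.
have aM : coprime a M.
  apply/eqP; have h : gcdn a M %| gcdn d M.
    rewrite dvdn_gcd dvdn_gcdr andbT dvdn_gcd dvdn_gcdl /=.
    by rewrite (dvdn_trans (dvdn_gcdr _ _)) // dN dvdn_mull.
  by apply/eqP; rewrite -dvdn1; move: dM => /eqP <-.
exists (totient M); first by rewrite totient_gt0.
rewrite expnS; case: (posnP a) => [->//|a0].
have t1 : 0 < a ^ totient M by rewrite expn_gt0 a0.
apply/eqP; rewrite eqn_mod_dvd; last by rewrite leq_pmulr.
have -> : a * a ^ totient M - a = a * (a ^ totient M - 1) by rewrite mulnBr muln1.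
rewrite [X in X %| _]dN dvdn_mul ?dvdn_gcdl //.
by rewrite -eqn_mod_dvd //; apply/eqP; exact: Euler_exp_totient.
Qed.

(** A monomial with exponent a at x_i and at least one more variable is nested
    into itself at x_i, all other variables of the inner copies being renamed to
    x_l. After t steps this gives x_i^(a^t) x_l^(b (1 + a + ... + a^(t-1))), where
    b > 0 is the sum of the other exponents. With t = NL, one last substitution
    into the original monomial restores its exponents modulo N, since
    a^(NL+1) is congruent to a, and leaves an extra factor of x_l whose exponent
    b (a + ... + a^(NL)) is positive and divisible by N, the powers of a being
    periodic with period L. *)
Lemma clone_expand N E n e i k l : 0 < N -> expo_clone N E -> square_free N ->
    vanishes_from n e -> i != k -> 0 < e i -> 0 < e k -> E e ->
  E (times_xN N l e).
Proof.
move=> N0 cE sN ve ik ei ek Ee.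
have [L L0 aL] := squarefree_expn_idem (e i) N0 sN.
set a := e i in aL.
have lt_n j : 0 < e j -> j < n.
  by move=> ej; rewrite ltnNge; apply/negP => /ve e0; rewrite e0 in ej.
pose b := \sum_(j < n | j != i :> nat) e j.
have b0 : 0 < b.
  rewrite /b (bigD1 (Ordinal (lt_n _ ek))) /=; last by rewrite eq_sym.
  by rewrite addn_gt0 ek.
pose h t j := a ^ t * (i == j) + b * (\sum_(u < t) a ^ u) * (l == j).
have split_i g g' j : (forall u, u != i -> g' u = g u) ->
    subst_expo n e g' j = a * g' i j + \sum_(u < n | u != i :> nat) e u * g u j.
  move=> gg'; rewrite /subst_expo (bigD1 (Ordinal (lt_n _ ei))) //=.
  by congr (_ + _); apply: eq_bigr => u ui; rewrite gg'.
have Eh t : E (h t).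
  elim: t => [|t IH].
    rewrite (_ : h 0 = var_expo i); first exact: clone_var cE _.
    by apply/funext => j; rewrite /h big_ord0 muln0 mul0n addn0 expn0 mul1n.
  have := @clone_subst _ _ cE n e (fun u => if u == i then h t else var_expo l) ve Ee.
  have -> : subst_expo n e (fun u => if u == i then h t else var_expo l) = h t.+1.
    apply/funext => j; rewrite (split_i (fun _ => var_expo l)); last first.
      by move=> u /negbTE ->.
    have -> : \sum_(u < n | u != i :> nat) e u * var_expo l j = b * (l == j).
      by rewrite -big_distrl.
    have sS : \sum_(u < t.+1) a ^ u = 1 + a * \sum_(u < t) a ^ u.
      rewrite big_ord_recl expn0 big_distrr /=; congr (_ + _).
      by apply: eq_bigr => u _; rewrite -expnS.
    rewrite eqxx /h sS expnS; ring.
  by apply=> u; case: ifP => // _; exact: clone_var cE _.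
pose T := N * L.
have TN : 0 < T by rewrite muln_gt0 N0.
have aT : a ^ T.+1 = a %[mod N].
  suff aLm m : a ^ (m * L).+1 = a %[mod N] by exact: aLm.
  elim: m => [|m IH]; first by rewrite mul0n expn1.
  by rewrite mulSn -addnS expnD -modnMm IH modnMm mulnC -expnS.
have sT : a * (\sum_(u < T) a ^ u) = 0 %[mod N].
  have -> : a * \sum_(u < T) a ^ u = \sum_(u < T) a ^ u.+1.
    by rewrite big_distrr /=; apply: eq_bigr => u _; rewrite expnS.
  suff Lm m : \sum_(u < m * L) a ^ u.+1 = m * (\sum_(u < L) a ^ u.+1) %[mod N].
    by rewrite Lm modnMr mod0n.
  elim: m => [|m IH]; first by rewrite big_ord0.
  rewrite !mulSn big_split_ord /= -modnDm -[in RHS]modnDm -IH; congr ((_ + _) %% _).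
  apply: modn_sum => u _.
  by rewrite -addnS -addSnnS expnD -modnMm aL modnMm -expnS.
have := @clone_subst _ _ cE n e (fun u => if u == i then h T else var_expo u) ve Ee.
have h' : forall u, E (if u == i then h T else var_expo u).
  by move=> u; case: ifP => // _; exact: clone_var cE _.
move=> /(_ h'); apply: (clone_equiv cE) => j.
rewrite (split_i var_expo); last by move=> u /negbTE ->.
have -> : times_xN N l e j = a * (i == j) +
    \sum_(u < n | u != i :> nat) e u * var_expo u j + N * (l == j).
  rewrite /times_xN -(split_i var_expo var_expo) // /subst_expo sum_delta.
  by case: ltnP => // /ve ->.
rewrite eqxx /h; set S := \sum_(u < T) a ^ u in sT *.
set R := \sum_(u < n | _) _.
have S0 : 0 < S.
  by rewrite /S -(prednK TN) big_ord_recl expn0.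
have -> : a * (a ^ T * (i == j) + b * S * (l == j)) + R =
    a ^ T.+1 * (i == j) + R + b * (a * S) * (l == j) by rewrite expnS; ring.
split.
  rewrite !addn_eq0 !muln_eq0 expn_eq0 !(gtn_eqF ei) !(gtn_eqF b0).
  by rewrite (gtn_eqF S0) (gtn_eqF N0).
rewrite -addnA -modnDm -modnMm aT modnMm.
have -> : R + b * (a * S) * (l == j) = R + N * (l == j) %[mod N].
  rewrite -modnDm -[in RHS]modnDm; congr ((_ + _) %% _).
  by rewrite mulnAC -modnMmr sT mod0n muln0 mod0n modnMr.
by rewrite modnDm addnA.
Qed.

(** * Monomials and their exponents *)

Lemma expcmnE (m : {cmonom nat}) n j : expcmn m n j = n * m j.
Proof.
have -> : expcmn m n = iter n (mmul m) mone.
  by rewrite /expcmn /iterop; case: n => // n; elim: n => //= [|n <-] //; rewrite mulm1.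
elim: n => [|n IH]; first by rewrite cm1 mul0n.
by rewrite iterS cmM IH mulSn.
Qed.

Lemma prod_varsE n (r : 'I_n -> nat) j :
  (\big[mmul/mone]_(i < n) expcmn (ucm (nat_of_ord i)) (r i) : {cmonom nat}) j =
  \sum_(i < n) r i * (i == j :> nat).
Proof.
apply: (big_ind2 (fun (m : {cmonom nat}) s => m j = s)) => [|m s m' s' <- <-|i _].
- exact: cm1.
- exact: cmM.
- by rewrite expcmnE cmU.
Qed.

Lemma cmonom_eqP (m m' : {cmonom nat}) : (forall i, m i = m' i) -> m = m'.
Proof. by move=> h; apply/eqP/cmP. Qed.

Lemma mI_leqP (m : monomial) n : mI m <= n <-> vanishes_from n (val m).
Proof.
split=> [mn i ni|v].
  apply/eqP; rewrite cmE_eq0; apply/negP => im.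
  have : i.+1 <= mI m by apply: (@leq_bigmax_seq _ _ xpredT (fun i => i.+1)).
  by move/leq_trans/(_ mn); rewrite ltnNge ni.
apply/bigmax_leqP_seq => i im _; rewrite ltnNge; apply/negP => /v /eqP.
by rewrite cmE_eq0 im.
Qed.

Lemma monomial_neq0 (m : monomial) : exists i, 0 < val m i.
Proof.
apply: contrapT => h; case: m h => m m1 /= h; move/negP: m1; apply.
apply/eqP/cmonom_eqP => i; rewrite cm1; apply/eqP.
by rewrite -[_ == _]negbK -lt0n; apply/negP => mi; apply: h; exists i.
Qed.

Lemma vanishes_gt0 n e : vanishes_from n e -> (exists i, 0 < e i) -> 0 < n.
Proof. by move=> v [i ei]; case: n v => // /(_ i isT) e0; rewrite e0 in ei. Qed.

Lemma exists_monomial n e : vanishes_from n e -> (exists i, 0 < e i) ->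
  exists m : monomial, val m =1 e.
Proof.
move=> v [i ei].
pose m : {cmonom nat} := \big[mmul/mone]_(i < n) expcmn (ucm (nat_of_ord i)) (e i).
have mE : m =1 e.
  by move=> j; rewrite prod_varsE sum_delta; case: ltnP => // /v.
have m1 : m != mone.
  by apply/eqP => m1; move: ei; rewrite -mE m1 cm1.
by exists (exist _ m m1).
Qed.

(** Closing up under equivalence makes membership of a monomial and of its
    exponent function interchangeable for monomial clones. *)
Definition expos (N : nat) (M : set monomial) : set (nat -> nat) :=
  [set e | exists2 m, M m & expo_equiv N (val m) e].

Lemma sub_expos N (M : set monomial) m : M m -> expos N M (val m).
Proof. by move=> Mm; exists m => //; exact: expo_equiv_refl. Qed.

Lemma expos_support N M e : expos N M e ->
  (exists n, vanishes_from n e) /\ exists i, 0 < e i.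
Proof.
move=> [m _ me]; split.
  by exists (mI m); apply: vanishes_equiv me _; apply/mI_leqP.
by have [i mi] := monomial_neq0 m; exists i; rewrite lt0n -(me i).1 -lt0n.
Qed.

Lemma subst_expo_neq0 n e s : vanishes_from n e -> (exists i, 0 < e i) ->
  (forall i, exists j, 0 < s i j) -> exists j, 0 < subst_expo n e s j.
Proof.
move=> v [i ei] /(_ i) [j sij]; exists j.
have i_n : i < n by rewrite ltnNge; apply/negP => /v e0; rewrite e0 in ei.
by rewrite /subst_expo (bigD1 (Ordinal i_n)) //= addn_gt0 muln_gt0 ei sij.
Qed.

Lemma subst_expo_vanishes K n e s :
  (forall i, i < n -> vanishes_from K (s i)) -> vanishes_from K (subst_expo n e s).
Proof. by move=> v j Kj; apply: big1 => i _; rewrite v ?muln0. Qed.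

(** * Induced functions *)

Lemma mkop_inj (A : Type) n : injective (@mkop A n).
Proof. by move=> f g; apply: Eqdep_dec.inj_pair2_eq_dec; exact: PeanoNat.Nat.eq_dec. Qed.

Section Induced.

Variables (F : finFieldType) (k : nat).
Hypothesis cardF : #|{: F}| = k.+2.
Local Notation N := k.+1.
Import GRing.Theory.
Local Open Scope ring_scope.

(** Evaluation at 0 detects whether an exponent is zero; evaluation at a
    generator of the cyclic group of units detects its class modulo q - 1. *)
Lemma expf_eqP (a b : nat) :
  (forall x : F, x ^+ a = x ^+ b) <-> (a == 0%N) = (b == 0%N) /\ a = b %[mod N].
Proof.
split=> [h|[ab0 ab] x].
  split.
    have := h 0; rewrite !expr0n; case: (a == 0%N); case: (b == 0%N) => // /eqP.
      by rewrite oner_eq0.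
    by rewrite eq_sym oner_eq0.
  have /cyclicP[u uE] := field_unit_group_cyclic [group of [set: {unit F}]].
  have ou : #[u]%g = N by rewrite orderE -uE card_finField_unit cardF.
  apply/eqP; rewrite -ou -eq_expg_mod_order; apply/eqP/val_inj.
  by rewrite !FinRing.val_unitX.
have [->|x0] := eqVneq x 0; first by rewrite !expr0n ab0.
have xN : x ^+ N = 1.
  by apply: (mulfI x0); rewrite -exprS -cardF expf_card mulr1.
by rewrite -(expr_mod a xN) ab expr_mod.
Qed.

Lemma induced_eqP (m m' : monomial) n : (mI m <= n)%N -> (mI m' <= n)%N ->
  @induced F m n = @induced F m' n <-> expo_equiv N (val m) (val m').
Proof.
move=> /mI_leqP vm /mI_leqP vm'; split=> [h i|h]; last first.
  by apply/funext => x; apply: eq_bigr => i _; exact: (expf_eqP _ _).2 (h i) (x i).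
case: (ltnP i n) => i_n; last by rewrite vm // vm'.
apply: (expf_eqP _ _).1 => y.
pose x : {ffun 'I_n -> F} := [ffun j : 'I_n => if j == i :> nat then y else 1].
have E (m0 : monomial) : induced m0 x = y ^+ val m0 i.
  rewrite /induced (bigD1 (Ordinal i_n)) //= ffunE eqxx big1 ?mulr1 // => j ji.
  by rewrite ffunE -val_eqE /= in ji *; rewrite (negbTE ji) expr1n.
by rewrite -!E h.
Qed.

Lemma equiv_monomialP (m m' : monomial) :
  equiv_monomial F m m' <-> expo_equiv N (val m) (val m').
Proof.
split=> [h|h].
  have mm : mI m = mI m' := congr1 (@projT1 _ _) h.
  move: h; rewrite /equiv_monomial mm => /mkop_inj.
  by move/induced_eqP; apply; rewrite ?mm.
have mm : mI m = mI m'.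
  apply/eqP; rewrite eqn_leq; apply/andP; split; apply/mI_leqP.
    by apply: vanishes_equiv (expo_equiv_sym h) _; apply/mI_leqP.
  by apply: vanishes_equiv h _; apply/mI_leqP.
rewrite /equiv_monomial mm; congr mkop.
by apply/induced_eqP => //; rewrite mm.
Qed.

Lemma induced_subst (m m' : monomial) (s : nat -> monomial) n K (x : {ffun 'I_K -> F}) :
  val m' =1 subst_expo n (val m) (fun i => val (s i)) ->
  induced m [ffun i : 'I_n => induced (s i) x] = induced m' x.
Proof.
move=> m'E; rewrite /induced.
under eq_bigr => i _ do rewrite ffunE -prodrXl.
rewrite exchange_big; apply: eq_bigr => j _ /=.
rewrite m'E /subst_expo -prodrXr; apply: eq_bigr => i _.
by rewrite -exprM mulnC.
Qed.

Lemma induced_ops_expos (M : set monomial) m n : (mI m <= n)%N ->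
  @induced_ops F M (mkop (@induced F m n)) -> expos N M (val m).
Proof.
move=> mn [m' [n' [Mm' mn' E]]].
have nn : n = n' := congr1 (@projT1 _ _) E.
move: mn' E; rewrite -nn => mn' /mkop_inj /esym /induced_eqP h.
by exists m' => //; apply: h.
Qed.

Lemma var_monomial i : exists m : monomial, val m =1 var_expo i.
Proof.
apply: (@exists_monomial i.+1); last by exists i; rewrite /var_expo eqxx.
by move=> j; rewrite /var_expo; case: ltngtP.
Qed.

Lemma subst_monomial (m : monomial) (s : nat -> monomial) n :
  vanishes_from n (val m) ->
  exists m' : monomial, val m' =1 subst_expo n (val m) (fun i => val (s i)).
Proof.
move=> v; pose K := (\max_(i < n) mI (s i))%N.
apply: (@exists_monomial K).
  apply: subst_expo_vanishes => i i_n; apply/mI_leqP.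
  exact: (@leq_bigmax _ (fun i : 'I_n => mI (s i)) (Ordinal i_n)).
by apply: subst_expo_neq0 => // [|i]; exact: monomial_neq0.
Qed.

(** The composite of induced functions of members of [M] is induced by some
    member of [M], which need not be the substituted monomial itself; it only
    induces the same function. Closure under equivalent monomials closes the
    gap, and allows the passage to exponent functions. *)
Theorem monomial_cloneP (M : set monomial) :
  @is_monomial_clone F M <->
  expo_clone N (expos N M) /\ (forall m : monomial, expos N M (val m) -> M m).
Proof.
split=> [[[arity proj comp] closed]|[[proj comp equ] closed]].
  split; last by move=> m' [m Mm mm']; apply: closed Mm; apply/equiv_monomialP.
  split=> [i|n e s ve [m Mm me] Es|e e' ee' [m Mm me]].
  - have [m mE] := var_monomial i; pose j : 'I_i.+1 := ord_max.
    have mi : (mI m <= i.+1)%N.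
      by apply/mI_leqP => u; rewrite mE /var_expo; case: ltngtP.
    have mF : mkop (fun x : {ffun 'I_i.+1 -> F} => x j) = mkop (@induced F m i.+1).
      congr mkop; apply/funext => x; rewrite /induced (bigD1 j) //= mE /var_expo eqxx expr1.
      rewrite big1 ?mulr1 // => u uj; rewrite mE /var_expo.
      by rewrite -val_eqE /= eq_sym in uj; rewrite (negbTE uj).
    have := proj _ j; rewrite mF => /(induced_ops_expos mi).
    by move=> [m' Mm' h]; exists m' => // u; rewrite -mE.
  - have /choice[t tP] : forall i, exists m, M m /\ expo_equiv N (val m) (s i).
      by move=> i; have [m' ? ?] := Es i; exists m'.
    have vm : vanishes_from n (val m) by apply: vanishes_equiv (expo_equiv_sym me) ve.
    have [m' m'E] := subst_monomial t vm.
    pose K := maxn (mI m') (\max_(i < n) mI (t i)).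
    have m'K : (mI m' <= K)%N by rewrite leq_maxl.
    have := comp n K (@induced F m n) (fun i : 'I_n => @induced F (t i) K).
    have -> : (fun x : {ffun 'I_K -> F} => induced m [ffun i : 'I_n => induced (t i) x])
        = @induced F m' K.
      by apply/funext => x; exact: induced_subst.
    case/(_ _ _)/(induced_ops_expos m'K) => [|i|m'' Mm'' E].
    + by exists m, n; split => //; apply/mI_leqP.
    + exists (t i), K; split=> //; first by case: (tP i).
      rewrite leq_max; apply/orP; right.
      exact: (@leq_bigmax _ (fun i : 'I_n => mI (t i)) i).
    + exists m'' => //; apply: expo_equiv_trans E _.
      move=> j; rewrite m'E; move: j; apply: subst_expo_equiv => // i.
      by case: (tP i).
  - by exists m => //; exact: expo_equiv_trans ee'.
split; last first.
  by move=> m m' /equiv_monomialP mm' Mm; apply: closed; exists m.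
split=> [_ [m [n [_ mn ->]]] /=|n i|n K f g [m [n' [Mm mn E]]] Eg].
- by apply: (vanishes_gt0 _ (monomial_neq0 m)); apply/mI_leqP.
- have [m mE] := var_monomial i; exists m, n; split.
  + by apply: closed; have [m' Mm' h] := proj i; exists m' => // u; rewrite mE.
  + apply/mI_leqP => u nu; rewrite mE /var_expo; case: eqP => // iu.
    by move: nu; rewrite -iu leqNgt ltn_ord.
  + congr mkop; apply/funext => x; rewrite /induced (bigD1 i) //= mE /var_expo eqxx expr1.
    rewrite big1 ?mulr1 // => u ui; rewrite mE /var_expo.
    by rewrite -val_eqE /= eq_sym in ui; rewrite (negbTE ui).
- have nn : n = n' := congr1 (@projT1 _ _) E.
  move: mn E; rewrite -nn => /mI_leqP vm /mkop_inj ->.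
  have /choice[t tP] : forall i : nat, exists m', M m' /\ forall i' : 'I_n, i' = i :> nat ->
      (mI m' <= K)%N /\ g i' = @induced F m' K.
    move=> i; case: (ltnP i n) => i_n; last first.
      by exists m; split=> // i' ii; move: i_n; rewrite -ii leqNgt ltn_ord.
    have [m' [K' [Mm' m'K E']]] := Eg (Ordinal i_n); exists m'; split=> // i' ii.
    have -> : i' = Ordinal i_n by exact: val_inj.
    have KK : K = K' := congr1 (@projT1 _ _) E'.
    by move: m'K E'; rewrite -KK => ? /mkop_inj.
  have [m' m'E] := subst_monomial t vm.
  have EM : expos N M (val m').
    have -> : val m' = subst_expo n (val m) (fun i => val (t i)) :> (nat -> nat) by apply/funext.
    apply: comp => // [|i]; apply: sub_expos => //; by case: (tP i).
  exists m', K; split; first exact: closed.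
    apply/mI_leqP => j jK; rewrite m'E; move: j jK; apply: subst_expo_vanishes => i i_n.
    by apply/mI_leqP; case: (tP i) => _ /(_ (Ordinal i_n) erefl) [].
  congr mkop; apply/funext => x; rewrite -(induced_subst _ m'E).
  congr (induced _ _); apply/ffunP => i; rewrite !ffunE.
  by case: (tP i) => _ /(_ i erefl) [_ ->].
Qed.

End Induced.

(** * Linear operations *)

Section Linear.

Variable k : nat.
Local Notation N := k.+1.
Local Notation lin n e := (mkop (linear_op k.+2 n (fun i : 'I_n => e i))).
Import GRing.Theory.

Lemma val_sum_Zp (I : Type) (r : seq I) (f : I -> 'I_N) :
  (\sum_(i <- r) f i)%R = (\sum_(i <- r) (f i : nat)) %% N :> nat.
Proof.
elim: r => [|i r IH]; first by rewrite !big_nil.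
by rewrite !big_cons -[in RHS]modnDmr -IH.
Qed.

(** Reading values as natural numbers reduces identities between linear
    operations to congruences, uniformly in N, including N = 1,
    where Z_N is the zero ring. *)
Lemma linear_opE n (r : 'I_n -> nat) (y : {ffun 'I_n -> 'I_N}) :
  linear_op k.+2 n r y = (\sum_(i < n) r i * y i) %% N :> nat.
Proof.
rewrite /linear_op val_sum_Zp; apply: modn_sum => i _ /=.
by rewrite modn_mod modnMml.
Qed.

Lemma linear_op_eqP n (r r' : 'I_n -> nat) :
  linear_op k.+2 n r = linear_op k.+2 n r' <-> forall i, r i = r' i %[mod N].
Proof.
split=> [h i|h].
  pose y : {ffun 'I_n -> 'I_N} := [ffun j => if j == i then inZp 1 else ord0].
  have E (s : 'I_n -> nat) : linear_op k.+2 n s y = s i %% N :> nat.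
    rewrite linear_opE (bigD1 i) //= ffunE eqxx big1 ?addn0 => [|j ji].
      by rewrite /= modnMmr muln1.
    by rewrite ffunE (negbTE ji) muln0.
  by rewrite -!E h.
apply/funext => y; apply: val_inj; rewrite /= !linear_opE.
by apply: modn_sum => i _; rewrite -modnMml h modnMml.
Qed.

Lemma linear_op_proj n (i : 'I_n) (r : 'I_n -> nat) :
  linear_op k.+2 n r = (fun y => y i) <-> forall j, r j = (i == j) %[mod N].
Proof.
have -> : (fun y : {ffun 'I_n -> 'I_N} => y i) = linear_op k.+2 n (fun j => i == j : nat).
  apply/funext => y; apply: val_inj; rewrite /= linear_opE (bigD1 i) //= eqxx mul1n.
  by rewrite big1 ?addn0 ?modn_small // => j /negbTE; rewrite eq_sym => ->.
exact: linear_op_eqP.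
Qed.

Lemma linear_op_comp n K (e : nat -> nat) (s : nat -> nat -> nat) (x : {ffun 'I_K -> 'I_N}) :
  linear_op k.+2 n (fun i => e i)
    [ffun i : 'I_n => linear_op k.+2 K (fun j => s i j) x] =
  linear_op k.+2 K (fun j => subst_expo n e s j) x.
Proof.
apply: val_inj; rewrite /= !linear_opE.
under [in RHS]eq_bigr => j _ do rewrite /subst_expo big_distrl.
rewrite exchange_big; apply: modn_sum => i _ /=.
rewrite ffunE linear_opE modnMmr big_distrr /=; congr (_ %% _).
by apply: eq_bigr => j _; rewrite mulnA.
Qed.

Lemma linear_op_affine n (r : 'I_n -> nat) :
  affine_op (linear_op k.+2 n r) /\ zero_preserving (linear_op k.+2 n r).
Proof.
have l0 : zero_preserving (linear_op k.+2 n r).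
  by apply: big1 => i _; rewrite ffunE; apply: val_inj; rewrite /= muln0 mod0n.
split=> // u v; rewrite l0 addr0 /linear_op -big_split.
by apply: eq_bigr => i _; rewrite ffunE; exact: Zp_mul_addr.
Qed.

(** The coefficients are the values at the unit vectors. They are represented
    by positive exponents, so that the corresponding product of powers is a
    monomial even if all coefficients vanish. *)
Lemma affine_op_linear n (f : op 'I_N n) : affine_op f -> zero_preserving f ->
  exists e : nat -> nat, [/\ vanishes_from n e, forall i, i < n -> 0 < e i
    & f = linear_op k.+2 n (fun i => e i)].
Proof.
move=> af f0.
have fD u v : f (u + v)%R = (f u + f v)%R by rewrite -af f0 addr0.
have fMn u m : f (u *+ m)%R = (f u *+ m)%R.
  by elim: m => [|m IH]; rewrite ?mulr0n // !mulrS fD IH.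
pose d (i : 'I_n) : {ffun 'I_n -> 'I_N} := [ffun j => if j == i then inZp 1 else ord0].
pose e j := if insub j is Some i then (f (d i) : nat) + N else 0.
have eE (i : 'I_n) : e i = f (d i) + N by rewrite /e valK.
exists e; split=> [i ni|i i_n|].
- by rewrite /e insubF // ltnNge ni.
- by rewrite (eE (Ordinal i_n)) addnS.
apply/funext => y.
have {1}-> : y = (\sum_(i < n) d i *+ y i)%R.
  apply/ffunP => j; rewrite sum_ffunE (bigD1 j) //= big1 => [|i ij].
    rewrite addr0 ffunMnE ffunE eqxx Zp_mulrn; apply: val_inj.
    by rewrite /= modnMml mul1n modn_small.
  by rewrite ffunMnE ffunE eq_sym (negbTE ij) mul0rn.
rewrite (big_morph f fD f0); apply: eq_bigr => i _; rewrite fMn Zp_mulrn eE.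
by apply: val_inj; rewrite /= modnMml -[in RHS]modnMml modnDr modnMml.
Qed.

(** The image of a set of monomials depends only on exponents up to
    equivalence, as linear operations see exponents modulo N. *)
Lemma phiP (G : set monomial) (f : operation 'I_N) :
  phi k.+2 G f <->
  exists n (e : nat -> nat), [/\ expos N G e, vanishes_from n e & f = lin n e].
Proof.
split=> [[n [r [m [n0 Gm mE ->]]]]|[n [e [[m Gm me] ve ->]]]].
  have mEj j : val m j = \sum_(i < n) r i * (i == j :> nat) by rewrite mE prod_varsE.
  exists n, (val m); split; first exact: sub_expos.
    move=> j nj; rewrite mEj big1 // => i _; case: eqP => [ij|]; last by rewrite muln0.
    by move: nj; rewrite -ij leqNgt ltn_ord.
  congr mkop; apply/linear_op_eqP => i; rewrite mEj (bigD1 i) //= eqxx muln1.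
  by rewrite big1 ?addn0 // => j /negbTE; rewrite -val_eqE /= => ->; rewrite muln0.
have vm : vanishes_from n (val m) by apply: vanishes_equiv (expo_equiv_sym me) ve.
exists n, (fun i : 'I_n => val m i), m; split=> //.
- exact: vanishes_gt0 vm (monomial_neq0 m).
- apply: cmonom_eqP => j; rewrite prod_varsE sum_delta.
  by case: ltnP => // /vm.
- by congr mkop; apply/linear_op_eqP => i; have [_ ->] := me i.
Qed.

Lemma phi_lin (G : set monomial) n (e : nat -> nat) : phi k.+2 G (lin n e) ->
  exists2 e', expos N G e' & vanishes_from n e' /\ forall i, i < n -> e' i = e i %[mod N].
Proof.
move=> /phiP[n' [e' [Ge ve E]]].
have nn : n = n' := congr1 (@projT1 _ _) E.
move: ve E; rewrite -nn => ve /mkop_inj/linear_op_eqP h.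
by exists e' => //; split=> // i i_n; have /= <- := h (Ordinal i_n).
Qed.

Lemma phi_clone (G : set monomial) : expo_clone N (expos N G) -> is_clone (phi k.+2 G).
Proof.
case=> proj comp _; split=> [f /phiP[n [e [Ge ve ->]]]|n i|n K f g].
- by apply: vanishes_gt0 ve (expos_support Ge).2.
- apply/phiP; exists n, (var_expo i); split=> //.
    by move=> j nj; rewrite /var_expo; case: eqP => // ij; move: nj; rewrite -ij leqNgt ltn_ord.
  by congr mkop; apply/esym/linear_op_proj.
move=> /phiP[n' [e [Ge ve E]]] Gg.
have nn : n = n' := congr1 (@projT1 _ _) E.
move: ve E; rewrite -nn => ve /mkop_inj ->.
have n0 : 0 < n by apply: vanishes_gt0 ve (expos_support Ge).2.
have /choice[s sP] : forall i : nat, exists s, [/\ expos N G s, i < n -> vanishes_from K s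
    & forall i' : 'I_n, i' = i :> nat -> g i' = linear_op k.+2 K (fun j => s j)].
  move=> i; case: (ltnP i n) => i_n; last first.
    by exists e; split=> // i' ii; move: i_n; rewrite -ii leqNgt ltn_ord.
  have /phiP[K' [s [Gs vs E]]] := Gg (Ordinal i_n); exists s.
  have KK : K = K' := congr1 (@projT1 _ _) E.
  move: vs E; rewrite -KK => ? /mkop_inj E; split=> // i' ii.
  by rewrite -E; congr g; exact: val_inj.
apply/phiP; exists K, (subst_expo n e s); split.
- by apply: comp => // i; case: (sP i).
- by apply: subst_expo_vanishes => i i_n; case: (sP i) => _ /(_ i_n).
- congr mkop; apply/funext => x; rewrite -linear_op_comp; congr (linear_op k.+2 n _ _).
  by apply/ffunP => i; rewrite !ffunE; case: (sP i) => _ _ /(_ i erefl) ->.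
Qed.

End Linear.

(** * The largest preimage of a semi-affine clone *)

Section FullPreimage.

Variables (k : nat) (C : set (operation 'I_k.+1)).
Local Notation N := k.+1.
Local Notation lin n e := (mkop (linear_op k.+2 n (fun i : 'I_n => e i))).
Hypothesis affC : is_semi_affine0_clone C.

(** The largest set of monomials that phi maps into [C]. *)
Definition full_preimage : set monomial :=
  [set m : monomial | exists2 n, vanishes_from n (val m) & C (lin n (val m))].

Lemma lin_equiv n (e e' : nat -> nat) : (forall i, e i = e' i %[mod N]) -> lin n e = lin n e'.
Proof. by move=> ee; congr mkop; apply/linear_op_eqP => i. Qed.

Lemma expos_full e : expos N full_preimage e <->
  exists n, [/\ vanishes_from n e, exists i, 0 < e i & C (lin n e)].
Proof.
split=> [[m [n vm Cm] me]|[n [ve e0 Ce]]].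
  exists n; split; first exact: vanishes_equiv me vm.
    by apply: (expos_support _).2; exists m => //; exists n.
  by rewrite -(@lin_equiv _ (val m)) // => i; case: (me i).
have [m mE] := exists_monomial ve e0.
have -> : e = val m by apply/funext => i; rewrite mE.
apply: sub_expos; exists n; first by move=> i /ve; rewrite mE.
by rewrite (@lin_equiv _ _ e) // => i; rewrite mE.
Qed.

(** Fictitious variables can be added and removed by substituting
    projections, so that membership in [C] does not depend on the arity at which
    a monomial is read. *)
Lemma clone_lin_resize n K (e : nat -> nat) : 0 < K -> vanishes_from n e -> vanishes_from K e ->
  C (lin n e) -> C (lin K e).
Proof.
case: affC => -[arity proj comp] _ K0 vn vK Ce.
pose p (i : nat) : 'I_K := insubd (Ordinal K0) i.
have := comp n K _ (fun i : 'I_n => fun x : {ffun 'I_K -> 'I_N} => x (p i)) Ce.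
move=> /(_ (fun i => proj _ _)); congr C; congr mkop.
have E (i : 'I_n) : (fun x : {ffun 'I_K -> 'I_N} => x (p i)) =
    linear_op k.+2 K (fun j => var_expo (p i) j).
  by apply/esym/linear_op_proj => j.
apply/funext => x; under eq_ffun => i do rewrite (congr1 (fun f => f x) (E i)).
rewrite (linear_op_comp n e (fun i => var_expo (p i))); congr (_ x).
apply/linear_op_eqP => j; congr (_ %% _).
have -> : e j = \sum_(i < n) e i * (i == j :> nat).
  by rewrite sum_delta; case: ltnP => // /vn.
apply: eq_bigr => i _; case: (ltnP i K) => iK; last by rewrite vK.
by rewrite /var_expo /p val_insubd iK.
Qed.

Lemma full_preimage_expo_clone : expo_clone N (expos N full_preimage).
Proof.
have [[arity proj comp] _] := affC; split=> [i|n e s ve Ce Cs|e e' ee' Ce].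
- apply/expos_full; exists i.+1; split.
  + by move=> j; rewrite /var_expo; case: ltngtP.
  + by exists i; rewrite /var_expo eqxx.
  + by rewrite (linear_op_proj k (@ord_max i) _).2.
- have /choice[d dP] : forall i, exists d, vanishes_from d (s i) /\ C (lin d (s i)).
    by move=> i; have /expos_full[d [? _ ?]] := Cs i; exists d.
  have [n' [ve' e0 Cn']] : exists n', [/\ vanishes_from n' e, exists i, 0 < e i & C (lin n' e)].
    exact/expos_full.
  pose n1 := maxn n n'; pose K := (\max_(i < n1) d i).+1.
  have dK i : i < n1 -> d i <= K.
    by move=> i1; apply: leqW; exact: (@leq_bigmax _ (fun i : 'I_n1 => d i) (Ordinal i1)).
  have -> : subst_expo n e s = subst_expo n1 e s.
    apply/funext => j; rewrite /subst_expo (big_ord_widen n1 (fun i => e i * s i j)) ?leq_maxl //.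
    by rewrite big_mkcond; apply: eq_bigr => i _; case: ltnP => // /ve ->.
  have ve1 : vanishes_from n1 e by apply: vanishes_leq ve; exact: leq_maxl.
  apply/expos_full; exists K; split.
  + by apply: subst_expo_vanishes => i i1; apply: vanishes_leq (dP i).1; exact: dK.
  + by apply: subst_expo_neq0 => // i; exact: (expos_support (Cs i)).2.
  + have C1 : C (lin n1 e) by apply: clone_lin_resize Cn' => //; exact: vanishes_gt0 ve1 e0.
    have := comp n1 K _ (fun i : 'I_n1 => linear_op k.+2 K (fun j => s i j)) C1.
    rewrite (_ : (fun x => _) = linear_op k.+2 K (fun j => subst_expo n1 e s j)).
      apply=> i; apply: clone_lin_resize (dP i).1 _ (dP i).2 => //.
      by apply: vanishes_leq (dP i).1; exact: dK.
    by apply/funext => x; exact: linear_op_comp.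
- have [m Cm me] := Ce; exists m => //; exact: expo_equiv_trans ee'.
Qed.

Lemma full_preimage_closed (m : monomial) : expos N full_preimage (val m) -> full_preimage m.
Proof. by move=> /expos_full[n [vm _ Cm]]; exists n. Qed.

Lemma phi_full_preimage : phi k.+2 full_preimage = C.
Proof.
have [[arity _ _] aff] := affC.
apply/seteqP; split=> [f /phiP[n [e [/expos_full[n' [ve' e0 Ce]] ve ->]]]|[n f] Cf].
  by apply: clone_lin_resize Ce => //; exact: vanishes_gt0 ve e0.
have [af f0] := aff _ _ Cf.
have [e [ve e0 fE]] := affine_op_linear af f0.
apply/phiP; exists n, e; split=> //; last by rewrite /mkop fE.
apply/expos_full; exists n; split=> //; last by rewrite -fE.
by exists 0; apply: e0; exact: arity Cf.
Qed.

End FullPreimage.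

(** * The full preimage and the fibers of phi *)

Section Fibers.

Variables (F : finFieldType) (k : nat).
Hypothesis cardF : #|{: F}| = k.+2.
Local Notation N := k.+1.
Local Notation lin n e := (mkop (linear_op k.+2 n (fun i : 'I_n => e i))).

Implicit Types (C : set (operation 'I_N)) (G : set monomial).

Lemma monomial_clone_expos G : monomial_clones F G -> expo_clone N (expos N G).
Proof. by move=> /(monomial_cloneP cardF)[]. Qed.

Lemma monomial_clone_closed G (m : monomial) :
  monomial_clones F G -> expos N G (val m) -> G m.
Proof. by move=> /(monomial_cloneP cardF)[_]; apply. Qed.

Lemma full_preimage_clone C : is_semi_affine0_clone C ->
  monomial_clones F (full_preimage C).
Proof.
move=> affC; apply/(monomial_cloneP cardF); split.
  exact: full_preimage_expo_clone.
exact: full_preimage_closed.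
Qed.

Lemma phi_semi_affine G : monomial_clones F G -> is_semi_affine0_clone (phi k.+2 G).
Proof.
move=> cG; split; first exact/phi_clone/monomial_clone_expos.
move=> n f /phiP[n' [e [_ _ E]]].
have nn : n = n' := congr1 (@projT1 _ _) E.
by move: E; rewrite -nn => /mkop_inj ->; exact: linear_op_affine.
Qed.

Lemma sub_full_preimage C G : phi k.+2 G `<=` C -> G `<=` full_preimage C.
Proof.
move=> GC m Gm; have vm : vanishes_from (mI m) (val m) by apply/mI_leqP.
exists (mI m) => //; apply: GC; apply/phiP; exists (mI m), (val m); split=> //.
exact: sub_expos.
Qed.

(** Every member of [full_preimage C] agrees modulo N with some member of
    [G]; this is the starting point for [clone_lift]. *)
Lemma full_preimage_lift C G (m : monomial) : C `<=` phi k.+2 G -> full_preimage C m ->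
  exists n (e : nat -> nat), [/\ expos N G e, vanishes_from n e, vanishes_from n (val m)
    & forall i, e i = val m i %[mod N]].
Proof.
move=> CG [n vm /CG /phi_lin[e Ge [ve em]]].
by exists n, e; split=> // i; case: (ltnP i n) => [/em|i_n] //; rewrite ve ?vm.
Qed.

Lemma x1E j : val x1 j = (0 == j). Proof. exact: cmU. Qed.

Lemma x1x2XE n j : val (x1x2X n) j = (0 == j) + n * (1 == j).
Proof. by rewrite /= cmM expcmnE !cmU. Qed.

(** Substituting m and x_l into x_1 x_2^N gives m x_l^N, so [clone_lift]
    applies with all of [G]. *)
Lemma full_preimage_sub C G : monomial_clones F G -> C `<=` phi k.+2 G ->
  G (x1x2X N) -> full_preimage C `<=` G.
Proof.
move=> cG CG Gx m Cm; have cE := monomial_clone_expos cG.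
have [n [e [Ge ve vm em]]] := full_preimage_lift CG Cm.
apply: (monomial_clone_closed cG).
apply: (@clone_lift N _ isT cE (expos N G) n e) => //; last exact: monomial_neq0.
move=> e0 l Ge0.
have := clone_subst (e := val (x1x2X N)) (n := 2)
  (s := fun i => if i == 0 then e0 else var_expo l) cE.
have -> : subst_expo 2 (val (x1x2X N)) (fun i => if i == 0 then e0 else var_expo l)
    = times_xN N l e0.
  apply/funext => j; rewrite /subst_expo !big_ord_recl big_ord0 !x1x2XE /=.
  by rewrite /times_xN /var_expo muln0 addn0 mul1n add0n muln1 addn0.
apply; first by move=> j j2; rewrite x1x2XE; case: j j2 => [|[|j]] //=; rewrite muln0.
  exact: sub_expos.
by move=> i; case: ifP => // _; exact: clone_var cE _.
Qed.

(** * The clone of projections *)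

Definition projections : set (operation 'I_N) :=
  [set f | exists n (i : 'I_n), f = mkop (fun y => y i)].

Lemma smallest_clone_projections :
  smallest (@is_clone 'I_N) set0 = projections.
Proof.
apply/seteqP; split.
  apply: smallest_sub => //; split=> [_ [n [i ->]]|n i|n K f g [n' [i E]] Pg].
  - exact: leq_ltn_trans (ltn_ord i).
  - by exists n, i.
  have nn : n = n' := congr1 (@projT1 _ _) E.
  move: i E; rewrite -nn => i /mkop_inj ->; have [K' [j E']] := Pg i.
  have KK : K = K' := congr1 (@projT1 _ _) E'.
  move: j E'; rewrite -KK => j /mkop_inj E'; exists K, j.
  by congr mkop; apply/funext => x; rewrite ffunE E'.
by move=> _ [n [i ->]] D [[_ proj _] _]; exact: proj.
Qed.

Lemma lin_projP n (e : nat -> nat) : projections (lin n e) ->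
  exists2 i, i < n & forall j, j < n -> e j = var_expo i j %[mod N].
Proof.
move=> [n' [i E]]; have nn : n = n' := congr1 (@projT1 _ _) E.
move: i E; rewrite -nn => i /mkop_inj/linear_op_proj h; exists i => // j j_n.
by rewrite (h (Ordinal j_n)).
Qed.

Lemma proj_lin n (e : nat -> nat) i : i < n -> (forall j, e j = var_expo i j %[mod N]) ->
  projections (lin n e).
Proof.
move=> i_n ei; exists n, (Ordinal i_n); congr mkop.
by apply/linear_op_proj => j; rewrite ei.
Qed.

(** The monomials that induce a projection. *)
Definition unit_monomials : set monomial :=
  [set m : monomial | exists i, expo_equiv N (val m) (var_expo i)].

Lemma expos_unit e : expos N unit_monomials e <-> exists i, expo_equiv N e (var_expo i).
Proof.
split=> [[m [i mi] me]|[i ei]].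
  by exists i; apply: expo_equiv_trans (expo_equiv_sym me) mi.
have [m mE] := var_monomial i; exists m.
  by exists i => j; rewrite mE.
by move=> j; rewrite mE; have [-> ->] := ei j.
Qed.

Lemma unit_monomials_clone : monomial_clones F unit_monomials.
Proof.
apply/(monomial_cloneP cardF); split; last by move=> m /expos_unit.
split=> [i|n e s ve /expos_unit[i ei] Us|e e' ee' /expos_unit[i ei]]; last first.
- by apply/expos_unit; exists i; exact: expo_equiv_trans (expo_equiv_sym ee') ei.
- have /expos_unit[j sj] := Us i; apply/expos_unit; exists j.
  have i_n : i < n.
    rewrite ltnNge; apply/negP => /ve e0; have := (ei i).1.
    by rewrite e0 /var_expo (eqxx i).
  have /choice[t tP] : forall u, exists t, expo_equiv N (s u) (var_expo t).
    by move=> u; exact/expos_unit.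
  apply: (@expo_equiv_trans _ _ (subst_expo n (var_expo i) s)).
    by apply: subst_expo_equiv => // v; exact: expo_equiv_refl.
  have -> // : subst_expo n (var_expo i) s = s i.
  apply/funext => u; rewrite /subst_expo (bigD1 (Ordinal i_n)) //= /var_expo eqxx mul1n.
  rewrite big1 ?addn0 // => v vi.
  by rewrite -val_eqE /= eq_sym in vi; rewrite (negbTE vi).
- by apply/expos_unit; exists i; exact: expo_equiv_refl.
Qed.

Lemma unit_monomials_sub G : monomial_clones F G -> unit_monomials `<=` G.
Proof.
move=> cG m [i mi]; have cE := monomial_clone_expos cG.
apply: (monomial_clone_closed cG); apply: (clone_equiv cE (expo_equiv_sym mi)).
exact: clone_var cE _.
Qed.

Lemma gen_x1 : gen_monomial_clone F [set x1] = unit_monomials.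
Proof.
apply/seteqP; split.
  apply: smallest_sub; first exact: unit_monomials_clone.
  by move=> _ ->; exists 0 => j; rewrite x1E.
by move=> m Um G [cG _]; exact: unit_monomials_sub cG _ Um.
Qed.

Lemma phi_unit_monomials : phi k.+2 unit_monomials = projections.
Proof.
apply/seteqP; split; last first.
  rewrite -smallest_clone_projections; apply: smallest_sub => //.
  exact/phi_clone/monomial_clone_expos/unit_monomials_clone.
move=> f /phiP[n [e [/expos_unit[i ei] ve ->]]].
apply: (@proj_lin _ _ i) => [|j]; last by have [] := ei j.
rewrite ltnNge; apply/negP => /ve e0; have := (ei i).1.
by rewrite e0 /var_expo (eqxx i).
Qed.

Lemma full_preimage_projections_x1x2X : full_preimage projections (x1x2X N).
Proof.
exists 2; first by move=> j; rewrite x1x2XE; case: j => [|[|j]] //=; rewrite muln0.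
by apply: (@proj_lin _ _ 0) => // j; rewrite x1x2XE -modnDmr modnMr addn0.
Qed.

Lemma gen_x1x2X : is_semi_affine0_clone projections ->
  gen_monomial_clone F [set x1x2X N] = full_preimage projections.
Proof.
move=> affP; apply/seteqP; split.
  apply: smallest_sub; first exact: full_preimage_clone.
  by move=> _ ->; exact: full_preimage_projections_x1x2X.
move=> m Um G [cG Gx]; apply: full_preimage_sub Um => //; last exact: Gx.
rewrite -smallest_clone_projections; apply: smallest_sub => //.
exact/phi_clone/monomial_clone_expos.
Qed.

(** A second variable would occur with an exponent divisible by N, and
    identifying all such variables would produce x_1 x_2^N. *)
Lemma sub_unit_monomials G : monomial_clones F G -> phi k.+2 G = projections ->
  ~ G (x1x2X N) -> G `<=` unit_monomials.
Proof.
move=> cG GP nGx m Gm; have cE := monomial_clone_expos cG.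
have [i [mi0 mi]] : exists i, 0 < val m i /\ forall j, val m j = var_expo i j %[mod N].
  have [n vm] : full_preimage projections m.
    by apply: (@sub_full_preimage _ G) => //; rewrite GP.
  move=> /lin_projP[i i_n mi].
  have {}mi j : val m j = var_expo i j %[mod N].
    case: (ltnP j n) => [/mi //|jn]; rewrite vm // /var_expo.
    by case: eqP jn => // <-; rewrite leqNgt i_n.
  (* The exponent at [i] is 1 modulo N, which forces it to be positive unless
     N = 1; then all exponents agree modulo N and any variable of m will do. *)
  case: (posnP (val m i)) => [mi0|]; last by exists i.
  have k0 : k = 0.
    by move: (mi i); rewrite mi0 /var_expo eqxx; case: (k) => // k'; rewrite modn_small.
  have [j mj] := monomial_neq0 m; exists j; split=> // u.
  by rewrite k0 !modn1.
exists i => j; split; last exact: mi.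
rewrite /var_expo; case: (eqVneq i j) => [<-|ij]; first by rewrite (gtn_eqF mi0).
apply/eqP; apply: contrapT => /eqP; rewrite -lt0n => mj; apply: nGx.
have vm : vanishes_from (mI m) (val m) by apply/mI_leqP.
apply: (monomial_clone_closed cG).
have mN v : i != v -> val m v = 0 %[mod N] by rewrite mi /var_expo => /negbTE ->.
have := clone_merge (ltn0Sn k) cE vm (sub_expos _ Gm) ij mi0 mj mN.
apply: (clone_equiv cE) => u; rewrite x1x2XE; split.
  rewrite !addn_eq0 !muln_eq0 (gtn_eqF mi0) /=.
  by case: (0 == u); case: (1 == u) => /=; rewrite ?orbF ?orbT.
have m0u : val m i * (0 == u) = (0 == u) %[mod N].
  by rewrite -modnMml mi /var_expo eqxx modnMml mul1n.
by rewrite -modnDml m0u modnDml.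
Qed.

Lemma phi_fiber_projections : is_semi_affine0_clone projections ->
  phi_fiber F k.+2 projections =
    [set gen_monomial_clone F [set x1]; gen_monomial_clone F [set x1x2X N]].
Proof.
move=> affP; rewrite gen_x1 gen_x1x2X //.
apply/seteqP; split=> [G [cG GP]|_ [->|->]].
- have [Gx|nGx] := pselect (G (x1x2X N)); [right|left].
    apply/seteqP; split; first by apply: sub_full_preimage; rewrite GP.
    by apply: full_preimage_sub => //; rewrite GP.
  apply/seteqP; split; first exact: sub_unit_monomials.
  exact: unit_monomials_sub.
- by split; [exact: unit_monomials_clone|exact: phi_unit_monomials].
- by split; [exact: full_preimage_clone|exact: phi_full_preimage].
Qed.

(** * Fibers consisting of one clone *)

Lemma phi_fiber_singleton C : is_semi_affine0_clone C ->
    (forall G, monomial_clones F G -> phi k.+2 G = C -> G (x1x2X N)) ->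
  phi_fiber F k.+2 C = [set full_preimage C].
Proof.
move=> affC hx; apply/seteqP; split=> [G [cG GC]|_ ->]; last first.
  by split; [exact: full_preimage_clone|exact: phi_full_preimage].
apply/seteqP; split; first by apply: sub_full_preimage; rewrite GC.
by apply: full_preimage_sub; rewrite ?GC //; exact: hx.
Qed.

(** * Fibers for square-free q - 1 *)

Definition x1a_x2N (a : nat) : nat -> nat := fun j => a * (0 == j) + N * (1 == j).

(** The class of a modulo N is represented by the positive exponent a + N. *)
Definition x1a_x2N_set G : {set 'I_N} :=
  [set a : 'I_N | `[< expos N G (x1a_x2N (a + N)) >]].

(** Let m be in [G1]. If m has one variable, then identifying all variables in
    a member of [G2] with the same exponents modulo N gives m. If m has several
    variables, it suffices by [clone_expand] and [clone_lift] to find a member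
    of [G2] that agrees with m modulo N and has at least two variables. Every
    member that agrees with m has this property when two exponents of m are
    nonzero modulo N; otherwise m collapses to some x_1^a x_2^N in [G1], which
    by assumption is also in [G2]. *)
Lemma phi_fiber_sub C G1 G2 : square_free N ->
  phi_fiber F k.+2 C G1 -> phi_fiber F k.+2 C G2 ->
  x1a_x2N_set G1 = x1a_x2N_set G2 -> G1 `<=` G2.
Proof.
move=> sN [cG1 GC1] [cG2 GC2] bits m Gm.
have [cE1 cE2] := (monomial_clone_expos cG1, monomial_clone_expos cG2).
have [n [e [Ge ve vm em]]] : exists n (e : nat -> nat), [/\ expos N G2 e,
    vanishes_from n e, vanishes_from n (val m) & forall i, e i = val m i %[mod N]].
  apply: (@full_preimage_lift C); first by rewrite GC2.
  by apply: sub_full_preimage Gm; rewrite GC1.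
apply: (monomial_clone_closed cG2).
have lt_n i : 0 < val m i -> i < n.
  by move=> mi; rewrite ltnNge; apply/negP => /vm e0; rewrite e0 in mi.
have [i mi] := monomial_neq0 m.
have [[j [ij mj]]|single] := pselect (exists j, i != j /\ 0 < val m j); last first.
  have := clone_rename cE2 (fun=> i) ve Ge; apply: (clone_equiv cE2) => u.
  have m0 j : j != i -> val m j = 0.
    move=> ji; apply/eqP; rewrite -[_ == _]negbK -lt0n; apply/negP => mj.
    by apply: single; exists j; rewrite eq_sym.
  rewrite -big_distrl /=; set S := \sum_(_ < n) _.
  have Sm : S = val m i %[mod N].
    have -> : S = \sum_(j < n) val m j %[mod N] by apply: modn_sum => j _; exact: em.
    rewrite (bigD1 (Ordinal (lt_n _ mi))) //=.
    by rewrite big1 ?addn0 // => j ji; apply: m0; rewrite -val_eqE in ji.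
  have [_ [j ej]] := expos_support Ge.
  have j_n : j < n by rewrite ltnNge; apply/negP => /ve e0; rewrite e0 in ej.
  have S0 : 0 < S by rewrite /S (bigD1 (Ordinal j_n)) //= addn_gt0 ej.
  have [<-|iu] := eqVneq i u.
    by rewrite muln1 (gtn_eqF S0) (gtn_eqF mi).
  by rewrite muln0 m0 // eq_sym.
(* A witness in [G2] with two variables [u] and [v] suffices. *)
have two_lift e' n' u v : expos N G2 e' -> vanishes_from n' e' -> u != v ->
    0 < e' u -> 0 < e' v -> (forall i, e' i = val m i %[mod N]) -> expos N G2 (val m).
  move=> Ge' ve' uv eu ev em'.
  apply: (@clone_lift N _ isT cE2
    [set e | [/\ expos N G2 e, 0 < e u, 0 < e v & exists n, vanishes_from n e]]
    (maxn n n') e').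
  - by move=> ? [].
  - move=> f l [Gf fu fv [d vf]]; split.
    + exact: (clone_expand _ _ cE2 sN vf uv fu fv Gf).
    + by rewrite addn_gt0 fu.
    + by rewrite addn_gt0 fv.
    + exists (maxn d l.+1) => w; rewrite geq_max => /andP[dw lw].
      by rewrite /times_xN vf // (ltn_eqF lw) muln0.
  - by split=> //; exists n'.
  - exact: em'.
  - by apply: vanishes_leq ve'; exact: leq_maxr.
  - by apply: vanishes_leq vm; exact: leq_maxl.
  - by exists i.
have [[u [v [uv mu mv]]]|nz] := pselect (exists u v, [/\ u != v,
    val m u %% N != 0 & val m v %% N != 0]).
  apply: (two_lift e n u v) => //.
    by rewrite lt0n; apply: contraNneq mu => eu; rewrite -em eu mod0n.
  by rewrite lt0n; apply: contraNneq mv => ev; rewrite -em ev mod0n.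
(* At most one exponent is nonzero modulo N; [u] is its variable. *)
have [u [mu mN]] : exists u, 0 < val m u /\ forall v, u != v -> val m v %% N = 0.
  have [iN|iN] := eqVneq (val m i %% N) 0; last first.
    exists i; split=> // v iv; apply/eqP; apply: contrapT => /negP mv; apply: nz.
    by exists i, v.
  have [[v mv]|all0] := pselect (exists v, val m v %% N != 0); last first.
    exists i; split=> // v _; apply/eqP; apply: contrapT => /negP mv; apply: all0.
    by exists v.
  exists v; split; first by rewrite lt0n; apply: contraNneq mv => ->; rewrite mod0n.
  move=> w vw; apply/eqP; apply: contrapT => /negP mw; apply: nz; by exists v, w.
have [w [uw mw]] : exists w, u != w /\ 0 < val m w.
  have [ui|ui] := eqVneq u i; last by exists i.
  by exists j; rewrite ui.
(* Transfer x_1^a x_2^N from [G1] to [G2] and rename it to x_u^a x_w^N. *)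
pose a : 'I_N := inZp (val m u).
have G1a : a \in x1a_x2N_set G1.
  rewrite inE; apply/asboolP.
  have mN' v : u != v -> val m v = 0 %[mod N] by move=> /mN ->; rewrite mod0n.
  have := clone_merge (ltn0Sn k) cE1 vm (sub_expos _ Gm) uw mu mw mN'.
  apply: (clone_equiv cE1) => x; split.
    by rewrite !addn_eq0 !muln_eq0 (gtn_eqF mu) addn_eq0 andbF.
  by rewrite -[in RHS]modnDml -modnMml modnDr modn_mod modnMml modnDml.
move: G1a; rewrite bits inE => /asboolP G2a.
have v2 : vanishes_from 2 (x1a_x2N (a + N)).
  by move=> [|[|x]] //= _; rewrite /x1a_x2N /= !muln0.
have := clone_rename cE2 (fun v => if v == 0 then u else w) v2 G2a.
rewrite (_ : (fun _ => _) = (fun j => (a + N) * (u == j) + N * (w == j))) => [G2e|]; last first.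
  apply/funext => x; rewrite !big_ord_recl big_ord0 /x1a_x2N /=.
  by rewrite !muln0 !muln1 !addn0 add0n.
apply: (two_lift _ (maxn u.+1 w.+1) u w G2e) => //.
- move=> x; rewrite geq_max => /andP[ux wx].
  by rewrite (ltn_eqF ux) (ltn_eqF wx) !muln0.
- by rewrite eqxx muln1 addnS.
- by rewrite eqxx muln1 addnS.
- move=> x; rewrite -modnDmr modnMr addn0; case: eqVneq => [<-|ux].
    by rewrite muln1 modnDr modn_mod.
  by rewrite muln0 mod0n mN.
Qed.

Lemma phi_fiber_finite C : square_free N -> finite_set (phi_fiber F k.+2 C).
Proof.
move=> sN; pose g (b : {set 'I_N}) : set monomial :=
  xget set0 [set G | phi_fiber F k.+2 C G /\ x1a_x2N_set G = b].
apply: (@sub_finite_set _ _ (g @` setT)); last exact: finite_image.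
move=> G CG; exists (x1a_x2N_set G) => //; rewrite /g.
case: xgetP => [G' _ [CG' bits]|/(_ G)]; last by move=> /(_ (conj CG erefl)).
apply/seteqP; split; first exact: phi_fiber_sub sN CG' CG bits.
exact: phi_fiber_sub sN CG CG' (esym bits).
Qed.

End Fibers.

Theorem proposition4p3 (q : nat)
    (hq : exists p k : nat, [/\ prime p, (0 < k)%N & q = (p ^ k)%N])
    (F : finFieldType) (hF : #|{: F}| = q) :
  [/\ set_fun (monomial_clones F) [set C | is_semi_affine0_clone C] (phi q),
      set_surj (monomial_clones F) [set C | is_semi_affine0_clone C] (phi q)
    & forall C : set (operation (Zqm1 q)), is_semi_affine0_clone C ->
      [/\ C = smallest (@is_clone (Zqm1 q)) set0 ->
            phi_fiber F q C =
              [set gen_monomial_clone F [set x1];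
                   gen_monomial_clone F [set x1x2X (q - 1)]],
          (forall G, monomial_clones F G -> phi q G = C -> G (x1x2X (q - 1))) ->
            phi_fiber F q C #= `I_1
        & square_free (q - 1) -> finite_set (phi_fiber F q C)]].
Proof.
have := card_finNzRing_gt1 F; case: q hq hF => [|[|k]] _ cardF; rewrite cardF // => _.
split=> [G cG|C affC|C affC].
- exact: phi_semi_affine cG.
- by exists (full_preimage C); [exact: full_preimage_clone|exact: phi_full_preimage].
have -> : k.+2 - 1 = k.+1 by rewrite subn1.
split=> [CP|hx|sN].
- rewrite smallest_clone_projections in CP; rewrite CP in affC *.
  exact: phi_fiber_projections.
- by rewrite (phi_fiber_singleton cardF affC hx); exact: card_set1.
- exact: phi_fiber_finite.
Qed.
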